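(* Let $(G,P,\theta)$ be an algebraic dynamical system satisfying: (a) the index $N_p:=[G:\theta_p(G)]$ is finite for all $p\in P$; (b) there exists $p\in P$ for which $\theta_p$ is not an automorphism of $G$; (c) if $\theta_p$ is an automorphism of $G$, then $p\in P^*$; (d) if $p,q\in P$ satisfy $N_p=N_q$, then $p\in qP^*$. Then the right LCM semigroup $S:=G\rtimes_\theta P$ has the following properties: (i) $S$ is admissible, and $\beta_c=1$ if $\mathrm{Irr}(P/_\sim)$ is finite. (ii) The action $\alpha$ is faithful if and only if $\bigcap_{(h,q)\in S}h\theta_q(G)h^{-1}=\{1\}$ and $$\bigcap_{(h,q)\in S}h\theta_q(G)\theta_p(h)^{-1}=\emptyset\quad\text{for all }p\in P^*\setminus\{1\}.$$ (iii) The action $\alpha$ is almost free if and only if $P^*$ is trivial and the set $\{[(g,p)]\in S/_\sim: h\in g\theta_p(G)g^{-1}\}$ is finite for all $h\in G\setminus\{1\}$.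
   Context: All semigroups are countable discrete monoids; $\mathbb{N}^\times$ is the multiplicative monoid of positive integers. **Algebraic dynamical systems.** $(G,P,\theta)$ is an action $\theta$ of a right LCM semigroup $P$ on a countable discrete group $G$ by injective endomorphisms $\theta_p$ such that $pP\cap qP=rP$ implies $\theta_p(G)\cap\theta_q(G)=\theta_r(G)$. $G\rtimes_\theta P$ is $G\times P$ with multiplication $(g,p)(h,q)=(g\theta_p(h),pq)$; it is a right LCM semigroup. **Right LCM semigroups.** A monoid $S$ is right LCM if it is left cancellative and for all $s,t\in S$ the set $sS\cap tS$ is empty or of the form $rS$; such $r$ is a right LCM of $s,t$. $S^*$ is the group of invertible elements. $S_c=\{a\in S: aS\cap sS\ne\emptyset\ \forall s\in S\}$. $S_{ci}$ is the set of $s\in S\setminus S_c$ such that every factorisation $s=ta$ with $a\in S_c$ forces $a\in S^*$; $S_{ci}^1=S_{ci}\cup\{1\}$. $s\sim t$ means $sa=tb$ for some $a,b\in S_c$; $[s]$ is the class of $s$. A transversal for $A/_\sim$, $A\subset S$, is a subset of $A$ that is a minimal complete set of representatives. A finite $F\subset S$ is a foundation set if every $s\in S$ satisfies $sS\cap fS\neq\emptyset$ for some $f\in F$; it is accurate if $fS\cap f'S=\emptyset$ for distinct $f,f'\in F$. **The quotient $P/_\sim$.** In $\mathrm{Irr}(P/_\sim)$, $\sim$ is the restriction to $P\cong\{1\}\times P\subset S$ of the core relation of $S$; it is given by $p\sim q\Leftrightarrow p\in qP^*$ and, under (d), is a congruence on $P$, so $P/_\sim$ is a monoid. $\mathrm{Irr}(M)$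 denotes the irreducible elements of a monoid $M$: those $m\neq1$ such that $m=kl$ with $k,l\in M$ implies $k=1$ or $l=1$. **Admissibility.** $S$ is admissible if: (A1) $S=S_{ci}^1S_c$; (A2) any right LCM of two elements of $S_{ci}$ belongs to $S_{ci}$; (A3) there is a nontrivial monoid homomorphism $N\colon S\to\mathbb{N}^\times$ (a generalised scale) such that (a) $|N^{-1}(n)/_\sim|=n$ for all $n\in N(S)$ and (b) for each $n\in N(S)$ every transversal of $N^{-1}(n)/_\sim$ is an accurate foundation set for $S$; (A4) $N(S)$ is the free abelian monoid in $\mathrm{Irr}(N(S))$. The critical inverse temperature $\beta_c$ is the smallest value such that $\zeta_S(\beta)=\sum_{n\in N(S)}n^{-(\beta-1)}$ is finite for all real $\beta>\beta_c$. Here the generalised scale on $S=G\rtimes_\theta P$ is $N(g,p)=N_p$. **The action $\alpha$.** $\alpha\colon S_c\curvearrowright S/_\sim$, $\alpha_a([s])=[as]$. It is faithful if for all $a\neq b$ in $S_c$ there is $x$ with $\alpha_a(x)\neq\alpha_b(x)$, and almost free if $\{x\in S/_\sim:\alpha_a(x)=\alpha_b(x)\}$ is finite for all $a\ne b$ in $S_c$. *)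

(* Defs.v *)
From HB Require Import structures.
From mathcomp Require Import all_boot all_order all_algebra finmap.
From mathcomp Require Import all_classical all_reals all_analysis.

Set Implicit Arguments.
Unset Strict Implicit.
Unset Printing Implicit Defensive.

Local Open Scope classical_set_scope.
Local Open Scope card_scope.
Local Open Scope group_scope.

Section RightLCM.
Variable S : monoidType.
Implicit Types (s t r a b : S) (A F T : set S).

Definition invertible : set S := [set s | exists2 t, s * t = 1 & t * s = 1].

Definition right_ideal s : set S := range (fun x => s * x).

Definition is_right_lcm s t r := right_ideal s `&` right_ideal t = right_ideal r.

Definition left_cancellative := forall s t u : S, s * t = s * u -> t = u.

Definition right_LCM :=
  left_cancellative /\
  forall s t, right_ideal s `&` right_ideal t = set0 \/
              exists r, is_right_lcm s t r.

(* S_c and S_ci *)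
Definition core : set S :=
  [set a | forall s, right_ideal a `&` right_ideal s !=set0].

Definition core_irr : set S :=
  [set s | ~ core s /\ forall t a, core a -> s = t * a -> invertible a].

Definition core_rel s t := exists a b, [/\ core a, core b & s * a = t * b].

(* The quotient of S by ~ is modelled by its set of equivalence classes;
   core_rel is an equivalence relation as soon as S is right LCM, see
   core_class_eqP below. *)
Definition core_class s : set S := [set t | core_rel s t].

Definition core_quot : set (set S) := range core_class.

Definition complete_reps A T :=
  T `<=` A /\ forall s, A s -> exists2 t, T t & core_rel s t.

Definition transversal A T :=
  complete_reps A T /\ forall T', T' `<=` T -> complete_reps A T' -> T' = T.

Definition foundation_set F :=
  finite_set F /\
  forall s, exists2 f, F f & right_ideal s `&` right_ideal f !=set0.

Definition accurate F :=
  forall f f', F f -> F f' -> f <> f' -> right_ideal f `&` right_ideal f' = set0.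

(* alpha_a([s]) = [as]; on classes the union below is the single class [as],
   see core_act_class. *)
Definition core_act a (X : set S) : set S :=
  \bigcup_(s in X) core_class (a * s).

Definition core_act_faithful :=
  forall a b, core a -> core b -> a <> b ->
    exists2 X, core_quot X & core_act a X <> core_act b X.

Definition core_act_almost_free :=
  forall a b, core a -> core b -> a <> b ->
    finite_set [set X | core_quot X /\ core_act a X = core_act b X].

End RightLCM.

Arguments invertible : clear implicits.
Arguments right_LCM : clear implicits.
Arguments core : clear implicits.
Arguments core_irr : clear implicits.
Arguments core_quot : clear implicits.
Arguments core_act_faithful : clear implicits.
Arguments core_act_almost_free : clear implicits.

(* Irreducible elements of the monoid with carrier M, product op, unit e. *)
Definition irreducibles (T : Type) (M : set T) (op : T -> T -> T) (e : T) :
    set T :=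
  [set m | [/\ M m, m <> e &
     forall k l, M k -> M l -> m = op k l -> k = e \/ l = e]].

(* Every element of M is the product of a unique finite multiset of elements
   of I, and all such products lie in M. *)
Definition free_abelian_monoid_on (M I : set nat) :=
  [/\ forall s : seq nat, {in s, forall x, I x} -> M (\prod_(x <- s) x)%N,
      forall n, M n ->
        exists2 s : seq nat, {in s, forall x, I x} & n = (\prod_(x <- s) x)%N &
      forall s t : seq nat, {in s, forall x, I x} -> {in t, forall x, I x} ->
        (\prod_(x <- s) x = \prod_(x <- t) x)%N -> perm_eq s t].

Section Admissibility.
Variables (S : monoidType) (N : S -> nat).

Definition nontrivial_hom :=
  [/\ forall s, (0 < N s)%N, N 1 = 1%N,
      forall s t, N (s * t) = (N s * N t)%N & exists s, N s <> 1%N].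

Definition generalised_scale :=
  [/\ nontrivial_hom,
      forall n, range N n -> @core_class S @` (N @^-1` [set n]) #= `I_n &
      forall n, range N n -> forall T, transversal (N @^-1` [set n]) T ->
        foundation_set T /\ accurate T].

Definition admissible :=
  [/\ forall s, exists t a,
        [/\ core_irr S t \/ t = 1, core S a & s = t * a],
      forall s t r, core_irr S s -> core_irr S t -> is_right_lcm s t r ->
        core_irr S r,
      generalised_scale &
      free_abelian_monoid_on (range N) (irreducibles (range N) muln 1%N)].

Variable R : realType.
Local Open Scope ring_scope.
Local Open Scope ereal_scope.

Definition zeta (beta : R) : \bar R :=
  \esum_(n in range N) ((n%:R `^ (- (beta - 1)))%R)%:E.

Definition beta_c : \bar R :=
  ereal_inf [set b : \bar R | forall beta : R, b < beta%:E -> zeta beta < +oo].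

End Admissibility.

Arguments beta_c {S} N R.

Section Index.
Variable G : groupType.

Definition left_cosets (H : set G) : set (set G) :=
  range (fun g => [set g * h | h in H]).

(* Equal to 0 when there are infinitely many cosets. *)
Definition group_index (H : set G) : nat := #|` fset_set (left_cosets H)|.

End Index.

Record algDynSys (G : groupType) (P : monoidType) := AlgDynSys {
  theta : P -> G -> G;
  ads_countableG : countable [set: G];
  ads_countableP : countable [set: P];
  ads_right_LCM : right_LCM P;
  theta1 : forall g, theta 1 g = g;
  thetaM : forall p q g, theta (p * q) g = theta p (theta q g);
  theta_morph : forall p, {morph theta p : g h / g * h};
  theta_inj : forall p, injective (theta p);
  theta_lcm : forall p q r, is_right_lcm p q r ->
    range (theta p) `&` range (theta q) = range (theta r)
}.

(* A record rather than an alias of G * P, which already carries the direct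
   product monoid structure. *)
Record sdprod (G : groupType) (P : monoidType) (A : algDynSys G P) :=
  SDProd { sdl : G; sdr : P }.

Arguments SDProd {G P} A sdl sdr.

Section Semidirect.
Variables (G : groupType) (P : monoidType) (A : algDynSys G P).
Local Notation S := (sdprod A).

Definition sd_pair (s : S) : G * P := (sdl s, sdr s).
Definition pair_sd (x : G * P) : S := SDProd A x.1 x.2.

Lemma sd_pairK : cancel sd_pair pair_sd. Proof. by case. Qed.

HB.instance Definition _ := Choice.copy S (can_type sd_pairK).

Definition sd_one : S := SDProd A 1 1.
Definition sd_mul (s t : S) : S :=
  SDProd A (sdl s * theta A (sdr s) (sdl t)) (sdr s * sdr t).

Lemma theta_one p : theta A p 1 = 1.
Proof.
apply: (@mulgI _ (theta A p 1)).
by rewrite -theta_morph !mulg1.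
Qed.

Lemma sd_mulA : associative sd_mul.
Proof.
by move=> [g p] [h q] [k r]; rewrite /sd_mul/= theta_morph thetaM !mulgA.
Qed.

Lemma sd_mul1 : left_id sd_one sd_mul.
Proof. by move=> [g p]; rewrite /sd_mul/= theta1 !mul1g. Qed.

Lemma sd_mulr1 : right_id sd_one sd_mul.
Proof. by move=> [g p]; rewrite /sd_mul/= theta_one !mulg1. Qed.

HB.instance Definition _ := isMonoid.Build S sd_mulA sd_mul1 sd_mulr1.

Definition ads_scale (s : S) : nat := group_index (range (theta A (sdr s))).

(* The relation ~ of S restricted to P, the set of its classes, and the product
   [p][q] = [pq] of classes. *)
Definition P_class (p : P) : set P :=
  [set q | core_rel (SDProd A 1 p : S) (SDProd A 1 q : S)].

Definition P_quot : set (set P) := range P_class.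

Definition P_quot_mul (X Y : set P) : set P :=
  \bigcup_(p in X) \bigcup_(q in Y) P_class (p * q).

Definition P_quot_irr : set (set P) :=
  irreducibles P_quot P_quot_mul (P_class 1).

End Semidirect.

Arguments ads_scale {G P} A s.
Arguments P_class {G P} A p.
Arguments P_quot_irr {G P} A.

Section Coherence.
Variable S : monoidType.
Hypothesis lcmS : right_LCM S.
Implicit Types s t a b : S.

Lemma core1 : core S 1.
Proof. by move=> s; exists s; split; [exists s; rewrite ?mul1g | exists 1; rewrite ?mulg1]. Qed.

Lemma coreM a b : core S a -> core S b -> core S (a * b).
Proof.
move=> ca cb s; have [_ [[w _ <-] [v _ vE]]] := ca s.
have [_ [[x _ <-] [y _ yE]]] := cb w.
exists (a * b * x); split; first by exists x.
by exists (v * y) => //; rewrite mulgA vE -!mulgA yE.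
Qed.

Lemma core_mulr b x : core S (b * x) -> core S x.
Proof.
move=> c s; have [_ [[w _ <-] [v _ vE]]] := c (b * s).
exists (x * w); split; first by exists w.
by exists v => //; apply: (lcmS.1 b); rewrite !mulgA.
Qed.

Lemma core_cap b c : core S b -> core S c ->
  exists x y, [/\ core S x, core S y & b * x = c * y].
Proof.
move=> cb cc; have [E|[r rE]] := lcmS.2 b c.
  by have [z] := cb c; rewrite E.
have cr : core S r.
  move=> s; have [z [[w _ wE] [v _ vE]]] := cb s.
  have [_ [[x _ <-] [y _ yE]]] := cc z.
  have : right_ideal r (c * x).
    rewrite -rE; split; last by exists x.
    by exists (w * y) => //; rewrite mulgA wE yE.
  move=> rx; exists (c * x); split => //.
  by exists (v * y) => //; rewrite mulgA vE yE.
have : right_ideal r r by exists 1; rewrite ?mulg1.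
rewrite -rE => -[[x _ xE] [y _ yE]].
exists x, y; split; last by rewrite xE yE.
- by apply: (@core_mulr b); rewrite xE.
- by apply: (@core_mulr c); rewrite yE.
Qed.

Lemma core_rel_refl s : core_rel s s.
Proof. by exists 1, 1; split => //; exact: core1. Qed.

Lemma core_rel_sym s t : core_rel s t -> core_rel t s.
Proof. by move=> [a [b [ca cb E]]]; exists b, a. Qed.

Lemma core_rel_trans s t u : core_rel s t -> core_rel t u -> core_rel s u.
Proof.
move=> [a [b [ca cb ab]]] [c [d [cc cd cdE]]].
have [x [y [cx cy xy]]] := core_cap cb cc.
exists (a * x), (d * y); split; [exact: coreM | exact: coreM |].
by rewrite mulgA ab -mulgA xy mulgA cdE mulgA.
Qed.

Lemma core_relMl a s t : core_rel s t -> core_rel (a * s) (a * t).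
Proof.
by move=> [b [c [cb cc E]]]; exists b, c; split => //; rewrite -!mulgA E.
Qed.

Lemma core_class_eqP s t : core_class s = core_class t <-> core_rel s t.
Proof.
split=> [E|st].
  by change (core_class s t); rewrite E; exact: core_rel_refl.
apply/seteqP; split=> u; apply: core_rel_trans => //.
exact: core_rel_sym.
Qed.

Lemma core_act_class a s : core_act a (core_class s) = core_class (a * s).
Proof.
apply/seteqP; split=> [u [t st]|u su].
  by apply: core_rel_trans; exact: core_relMl.
by exists s => //; exact: core_rel_refl.
Qed.

End Coherence.

Section CoherenceSemidirect.
Variables (G : groupType) (P : monoidType) (A : algDynSys G P).
Local Notation S := (sdprod A).

Lemma theta_inv p g : theta A p g^-1 = (theta A p g)^-1.
Proof. by apply/esym/mulg1_eq; rewrite -theta_morph mulgV theta_one. Qed.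

Lemma sd_right_idealP (s t : S) : right_ideal s t <->
  right_ideal (sdr s) (sdr t) /\ range (theta A (sdr s)) ((sdl s)^-1 * sdl t).
Proof.
case: s t => [g p] [h q]; split=> /=.
  move=> [[k r] _ [<- <-]]; split; first by exists r.
  by exists k => //; rewrite mulKg.
move=> [[r _ <-] [k _ kE]]; exists (SDProd A k r) => //.
by change (SDProd A (g * theta A p k) (p * r) = SDProd A h (p * r)); rewrite kE mulVKg.
Qed.

Lemma sd_right_LCM : right_LCM (sdprod A).
Proof.
split=> [[g p] [h q] [k r] [/mulgI/theta_inj -> ] /(ads_right_LCM A).1 -> //|].
move=> [g p] [h q].
have [->|/set0P[[k z] [/sd_right_idealP/=[zp gk] /sd_right_idealP/=[zq hk]]]] :=
  eqVneq (right_ideal (SDProd A g p : S) `&` right_ideal (SDProd A h q : S)) set0.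
  by left.
right; have [E|[r rE]] := (ads_right_LCM A).2 p q.
  by exfalso; move: E => /seteqP[+ _] => /(_ z); apply.
have tE := theta_lcm A rE.
exists (SDProd A k r); rewrite /is_right_lcm; apply/seteqP; split=> -[l w].
  move=> [/sd_right_idealP/=[wp gl] /sd_right_idealP/=[wq hl]].
  apply/sd_right_idealP => /=; split; first by rewrite -rE.
  suff : (range (theta A p) `&` range (theta A q)) (k^-1 * l) by rewrite tE.
  split.
    move: gk gl => [x _ xE] [y _ yE]; exists (x^-1 * y) => //.
    by rewrite theta_morph theta_inv xE yE invgM invgK mulgA mulgK.
  move: hk hl => [x _ xE] [y _ yE]; exists (x^-1 * y) => //.
  by rewrite theta_morph theta_inv xE yE invgM invgK mulgA mulgK.
move=> /sd_right_idealP/=[]; rewrite -rE => -[wp wq] rkl.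
have : (range (theta A p) `&` range (theta A q)) (k^-1 * l) by rewrite tE.
move=> [[x _ xE] [y _ yE]].
split; apply/sd_right_idealP => /=; split=> //.
  move: gk => [u _ uE]; exists (u * x) => //.
  by rewrite theta_morph uE xE mulgA mulgK.
move: hk => [u _ uE]; exists (u * y) => //.
by rewrite theta_morph uE yE mulgA mulgK.
Qed.

Lemma P_class_eqP p q : P_class A p = P_class A q <->
  core_rel (SDProd A 1 p : S) (SDProd A 1 q : S).
Proof.
split=> [E|pq].
  by change (P_class A p q); rewrite E; exact: core_rel_refl.
apply/seteqP; split=> u; apply: (core_rel_trans sd_right_LCM) => //.
exact: core_rel_sym.
Qed.

Lemma P_quot_mul_class p q :
  (forall p' q', P_class A p p' -> P_class A q q' -> P_class A (p * q) (p' * q')) ->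
  P_quot_mul A (P_class A p) (P_class A q) = P_class A (p * q).
Proof.
move=> cong; apply/seteqP; split=> [u [p' pp' [q' qq']]|u pqu].
  by apply: (core_rel_trans sd_right_LCM); exact: cong.
by exists p; [exact: core_rel_refl | exists q => //; exact: core_rel_refl].
Qed.

End CoherenceSemidirect.

(* Main.v *)
Require Import Defs.
From HB Require Import structures.
From mathcomp Require Import all_boot all_order all_algebra finmap.
From mathcomp Require Import all_classical all_reals all_analysis.

(** The core of [S = G x| P] is as small as it can be, and this reduces each
    claim to counting cosets.

    The index [N_p] of [theta_p(G)] in [G] is multiplicative in [p]
    ([group_index_comp]), because [theta_p] is injective. By hypothesis it
    determines [p] up to a unit; comparing with [N_1 = 1], the elements of index
    1 are the units. If [(g, p)] is in the core, its right ideal meets those of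
    all [(h, p)], which forces [theta_p(G) = G]; so the core is [G x P^*], the
    group of units of [S] ([core_pairE]). Hence the conditions on
    core-irreducible elements hold as in every right LCM monoid whose core is a
    group, and [(g, p) ~ (h, q)] means that
    [N_p = N_q] and that [g] and [h] lie in the same coset of [theta_q(G)]
    ([core_rel_pairE]). This counts the classes of a given scale. As
    [N_(pq) = N_(qp)], the elements [pq] and [qp] differ by a unit, so right
    ideals of [P] always meet; transversals are therefore accurate foundation
    sets ([transversal_foundation]).

    For freeness, note that divisibility inside the monoid of scales is divisibility in [P]
    up to units, so the right LCM property gives least common multiples of scales
    ([range_scale_lcm]). A multiplicative set of positive integers with least
    common multiples has prime irreducibles ([irr_prime]) and so unique
    factorisation ([lcm_submonoid_free]).

    The map [p |-> N_p] identifies [P/~] with the monoid of scales, irreducibles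
    included. If there are finitely many of them, the zeta function is bounded for
    [beta > 1] by a finite Euler product ([products_sum_bounded]), while at
    [beta = 1] it sums infinitely many ones.

    Finally, as the core is a group, [alpha_a] and [alpha_b] agree at a point
    exactly when [alpha_(b^-1 a)] fixes it, and [(g, u)] fixes the class of
    [(h, q)] exactly when [g] is in [h theta_q(G) theta_u(h)^-1] ([core_fixE]).
    Faithfulness and almost freeness become the stated conditions on these sets.
    A nontrivial unit [u] rules out almost freeness, since [(1, u)] fixes the
    class of every [(1, q)] ([almost_free_units]). *)

Set Implicit Arguments.
Unset Strict Implicit.
Unset Printing Implicit Defensive.

Local Open Scope classical_set_scope.
Local Open Scope card_scope.
Local Open Scope group_scope.

(** * Submonoids of the positive integers with least common multiples *)

Section LcmSubmonoid.
Local Open Scope nat_scope.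
Variable M : set nat.
Hypothesis M_gt0 : forall n, M n -> 0 < n.
Hypothesis M1 : M 1.
Hypothesis MM : forall m n, M m -> M n -> M (m * n).

Definition dvd_in a b := exists2 c, M c & b = a * c.

Hypothesis M_lcm : forall a b, M a -> M b ->
  exists r, forall x, dvd_in a x /\ dvd_in b x <-> dvd_in r x.

Notation irrM := (irreducibles M muln 1).

Lemma submonoid_prod (I : set nat) (s : seq nat) : I `<=` M ->
  {in s, forall x, I x} -> M (\prod_(x <- s) x).
Proof.
move=> IM; elim: s => [|x s IH] sI; first by rewrite big_nil.
rewrite big_cons; apply: MM; first by apply: IM; apply: sI; rewrite mem_head.
by apply: IH => y ys; apply: sI; rewrite inE ys orbT.
Qed.

Lemma irr_sub : irrM `<=` M. Proof. by move=> m []. Qed.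

Lemma irr_gt1 m : irrM m -> 1 < m.
Proof. by move=> [/M_gt0 m0 m1 _]; rewrite ltn_neqAle m0 eq_sym andbT; apply/eqP. Qed.

(** The usual argument that irreducibles are prime once lcms exist: if [m] does
    not divide [a], then [lcm m a] is a divisor of [m * a] that can only be
    [m * a] itself, so the common multiple [a * b] is divisible by [m * a]. *)
Lemma irr_prime m a b : irrM m -> M a -> M b -> dvd_in m (a * b) ->
  dvd_in m a \/ dvd_in m b.
Proof.
move=> irr_m Ma Mb mab; have [Mm _ m_irr] := irr_m.
have [r rP] := M_lcm Mm Ma.
have [[d Md rmd] [c Mc rac]] : dvd_in m r /\ dvd_in a r.
  by apply/rP; exists 1 => //; rewrite muln1.
have [e Me mae] : dvd_in r (m * a).
  by apply/rP; split; [exists a | exists m; rewrite 1?mulnC].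
have mce : m = c * e.
  apply/eqP; rewrite -(eqn_pmul2l (M_gt0 Ma)) mulnA -rac -mae; exact/eqP/mulnC.
have [c1|e1] := m_irr c e Mc Me mce.
  by left; exists d => //; rewrite -rmd rac c1 muln1.
have [x Mx abx] : dvd_in r (a * b) by apply/rP; split=> //; exists b.
right; exists x => //; apply/eqP; rewrite -(eqn_pmul2l (M_gt0 Ma)) abx mulnA.
by apply/eqP; rewrite rac mce e1 muln1.
Qed.

Lemma irr_dvd_prod m s : irrM m -> {in s, forall x, irrM x} ->
  dvd_in m (\prod_(x <- s) x) -> m \in s.
Proof.
move=> irr_m; elim: s => [|x s IH] sI.
  rewrite big_nil => -[c _ /esym/eqP]; rewrite muln_eq1 => /andP[/eqP m1 _].
  by have := irr_gt1 irr_m; rewrite m1.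
have irr_x : irrM x by apply: sI; rewrite mem_head.
have {}sI : {in s, forall x, irrM x} by move=> y ys; apply: sI; rewrite inE ys orbT.
rewrite big_cons inE => /(irr_prime irr_m (irr_sub irr_x) (submonoid_prod irr_sub sI)).
case=> [[c Mc xmc]|/(IH sI) ->]; last by rewrite orbT.
have [_ m1 _] := irr_m; have [_ _ /(_ _ _ (irr_sub irr_m) Mc xmc)[//|c1]] := irr_x.
by rewrite xmc c1 muln1 eqxx.
Qed.

Lemma irr_factorisation n : M n ->
  exists2 s : seq nat, {in s, forall x, irrM x} & n = \prod_(x <- s) x.
Proof.
elim/ltn_ind: n => n IH Mn; have [->|/eqP n1] := eqVneq n 1.
  by exists [::]; rewrite ?big_nil.
have [irr_n|] := pselect (irrM n).
  by exists [:: n]; rewrite ?big_seq1 // => x; rewrite inE => /eqP ->.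
move=> nirr; have [k [l [Mk Ml nkl k1 l1]]] :
    exists k l, [/\ M k, M l, n = k * l, k <> 1 & l <> 1].
  apply: contrapT => kl; apply: nirr; split=> // k l Mk Ml nkl.
  by apply: contrapT => /not_orP[k1 l1]; apply: kl; exists k, l.
have gt1 x : M x -> x <> 1 -> 1 < x.
  by move=> /M_gt0 x0 /eqP x1; rewrite ltn_neqAle eq_sym x1.
have [|//|s sI sE] := IH k; first by rewrite nkl ltn_Pmulr ?gt1 ?M_gt0.
have [|//|t tI tE] := IH l; first by rewrite nkl ltn_Pmull ?gt1 ?M_gt0.
exists (s ++ t); last by rewrite big_cat -sE -tE.
by move=> x; rewrite mem_cat => /orP[/sI|/tI].
Qed.

Lemma lcm_submonoid_free : free_abelian_monoid_on M irrM.
Proof.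
split; first by move=> s; exact: submonoid_prod irr_sub.
  exact: irr_factorisation.
elim=> [|x s IH] t sI tI.
  case: t tI => [//|y t] tI; rewrite big_nil big_cons => /esym/eqP.
  rewrite muln_eq1 => /andP[/eqP y1 _].
  by have := irr_gt1 (tI y (mem_head _ _)); rewrite y1.
have irr_x : irrM x by apply: sI; rewrite mem_head.
have {}sI : {in s, forall x, irrM x} by move=> y ys; apply: sI; rewrite inE ys orbT.
rewrite big_cons => E; have xt : x \in t.
  apply: irr_dvd_prod => //; exists (\prod_(y <- s) y) => //.
  exact: submonoid_prod irr_sub sI.
have px := perm_to_rem xt; rewrite perm_sym (permPl px) perm_cons perm_sym.
apply: IH => // [y /mem_rem|]; first exact: tI.
apply/eqP; rewrite -(eqn_pmul2l (M_gt0 (irr_sub irr_x))) E.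
by rewrite (perm_big _ px) big_cons.
Qed.

End LcmSubmonoid.

(** * Sums of multiplicative weights over finitely generated sets of integers *)

Section EulerProduct.
Import Order.TTheory GRing.Theory Num.Theory.
Variable R : realType.
Local Open Scope ring_scope.
Variable w : nat -> R.
Hypothesis w_ge0 : forall n, 0 <= w n.
Hypothesis w1 : w 1%N = 1.
Hypothesis wM : forall m n, w (m * n)%N = w m * w n.

Definition products (L : seq nat) : set nat :=
  [set n | exists2 s : seq nat, {subset s <= L} & n = (\prod_(x <- s) x)%N].

Lemma sum_pred1_le (F : nat -> R) k B : (forall n, 0 <= F n) ->
  \sum_(0 <= n < B | n == k) F n <= F k.
Proof.
move=> F0; have [kB|kB] := boolP (k \in index_iota 0 B).
  by rewrite -big_filter filter_pred1_uniq ?iota_uniq // big_seq1.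
by rewrite big1_seq // => i /andP[/eqP ->]; rewrite (negPf kB).
Qed.

Lemma products_cons x L n : products (x :: L) n ->
  products L n \/ exists2 m, products (x :: L) m & n = (x * m)%N.
Proof.
move=> [s sL ->]; have [xs|xs] := boolP (x \in s).
  right; exists (\prod_(y <- rem x s) y)%N; last first.
    by rewrite (perm_big _ (perm_to_rem xs)) big_cons.
  by exists (rem x s) => // y /mem_rem; exact: sL.
left; exists s => // y ys; have := sL _ ys; rewrite inE => /orP[/eqP yx|//].
by move: xs; rewrite -yx ys.
Qed.

(** A product of entries of [x :: L] either avoids [x] or is [x] times another
    such product. If [C] bounds the sums over [L], the truncated sum [f] over
    [x :: L] therefore satisfies [f <= C + w x * f], so that
    [f <= C / (1 - w x)], one factor of the Euler product. Truncating keeps [f]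
    finite, which is what allows it to be moved to the left. *)
Lemma products_sum_bounded (L : seq nat) :
  {in L, forall x, (0 < x)%N /\ w x < 1} ->
  exists C : R, forall B, \sum_(0 <= n < B | n \in products L) w n <= C.
Proof.
elim: L => [|x L IH] Lw.
  exists 1 => B; rewrite -w1; apply: le_trans (@sum_pred1_le (fun=> w 1%N) 1 B _) => //.
  rewrite big_mkcond [leRHS]big_mkcond; apply: ler_sum => n _ /=.
  case: ifPn => [|_]; last by case: ifP.
  rewrite inE => -[[|y s] sL ->]; first by rewrite big_nil eqxx.
  by have := sL y (mem_head _ _).
have [C CP] : exists C, forall B, \sum_(0 <= n < B | n \in products L) w n <= C.
  by apply: IH => y yL; apply: Lw; rewrite inE yL orbT.
have [x0 wx] := Lw _ (mem_head x L).
exists (C / (1 - w x)) => B; rewrite ler_pdivlMr ?subr_gt0 //.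
set f := (X in X * _); rewrite mulrBr mulr1 lerBlDr [f * _]mulrC.
apply: le_trans (lerD (CP B) (lexx _)).
rewrite {1}/f mulr_sumr.
pose Q m := m \in products (x :: L).
apply: (@le_trans _ _ (\sum_(0 <= n < B | n \in products L) w n +
  \sum_(0 <= n < B) \sum_(0 <= m < B | Q m) if n == (x * m)%N then w n else 0)).
  rewrite [X in _ <= X + _]big_mkcond -big_split big_mkcond /= big_nat_cond.
  rewrite [X in _ <= X]big_nat_cond; apply: ler_sum => n; rewrite andbT => nB.
  have S0 : 0 <= \sum_(0 <= m < B | Q m) if n == (x * m)%N then w n else 0.
    by apply: sumr_ge0 => m _; case: ifP.
  case: ifPn => [|_]; last by rewrite addr_ge0 //; case: ifP.
  rewrite inE => /products_cons[nL|[m mL nE]].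
    by rewrite (mem_set nL) lerDl.
  rewrite -[leLHS]add0r lerD //; first by case: ifP.
  have mB : m \in index_iota 0 B.
    by rewrite mem_index_iota (leq_ltn_trans _ nB) // nE leq_pmull.
  rewrite (big_rem m mB) /Q (mem_set mL) /= nE eqxx lerDl.
  by apply: sumr_ge0 => k _; case: ifP.
(* For fixed [m], at most one [n] equals [x * m]. *)
rewrite lerD2l exchange_big /=; apply: ler_sum => m _.
rewrite -big_mkcond /= -wM.
exact: sum_pred1_le.
Qed.

End EulerProduct.

(** * The critical inverse temperature *)

Section CriticalTemperature.
Import Order.TTheory GRing.Theory Num.Theory.
Variables (R : realType) (S : monoidType) (N : S -> nat).
Local Open Scope ring_scope.
Local Open Scope ereal_scope.

(** At [beta = 1] every term of the series is 1. *)
Lemma zeta1_infinite : infinite_set (range N) -> zeta N (1 : R) = +oo.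
Proof.
move=> Ninf; apply/eqyP => x x0.
have [X XN Xx] := (infinite_set_fsetP _).1 Ninf (Num.truncn x).+1.
apply: (@le_trans _ _ (\sum_(i \in [set` X]) ((i%:R : R) `^ (- (1 - 1)))%R%:E)).
  rewrite fsbig_finite ?set_fsetK //= (eq_bigr (fun=> 1%:E)); last first.
    by move=> i _; rewrite subrr oppr0 powRr0.
  rewrite sumEFin big_const_seq count_predT iter_addr_0 lee_fin.
  apply: (@le_trans _ _ (Num.truncn x).+1%:R%R).
    exact/ltW/real_truncnS_gt/num_real.
  by rewrite ler_nat.
by apply: esum_ge; exists [set` X].
Qed.

Lemma zeta_finite (L : seq nat) (beta : R) : {in L, forall x, (1 < x)%N} ->
  range N `<=` products L -> (1 < beta)%R -> zeta N beta < +oo.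
Proof.
move=> L1 NL b1; pose w (n : nat) := ((n%:R : R) `^ (- (beta - 1)))%R.
have w0 n : (0 <= w n)%R by exact: powR_ge0.
have wM m n : w (m * n)%N = (w m * w n)%R by rewrite /w natrM powRM.
have Lw : {in L, forall x, (0 < x)%N /\ (w x < 1)%R}.
  move=> x /L1 x1; split; first exact: ltnW.
  rewrite /w powRN invf_lt1 ?powR_gt0 ?ltr0n ?(ltnW x1) //.
  have b0 : (0 < beta - 1)%R by rewrite subr_gt0.
  rewrite -[ltLHS](congr1 (@^~ (beta - 1)%R) (@powR1 R)).
  by apply: gt0_ltr_powR => //; rewrite ?nnegrE ?ltr1n.
have [C CP] := products_sum_bounded w0 (congr1 (@^~ _) (@powR1 R)) wM Lw.
have wE : \esum_(n in [set n | n \in products L]) (w n)%:E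
    = \sum_(n <oo | n \in products L) (w n)%:E.
  by rewrite nneseries_esum // => n _; rewrite lee_fin.
apply: (@le_lt_trans _ _ (\esum_(n in [set n | n \in products L]) (w n)%:E)).
  apply: ge_ereal_sup => _ [X [finX XN] <-]; apply: esum_ge; exists X => //.
  by split=> // n /XN/NL nL /=; exact: mem_set.
rewrite wE; apply: (@le_lt_trans _ _ C%:E); last exact: ltry.
apply: lime_le; first by apply: is_cvg_nneseries => n _ _; rewrite lee_fin.
by apply: nearW => B; rewrite sumEFin lee_fin.
Qed.

Lemma beta_c_eq1 (L : seq nat) : {in L, forall x, (1 < x)%N} ->
  range N `<=` products L -> infinite_set (range N) -> beta_c N R = 1.
Proof.
move=> L1 NL Ninf; apply/eqP; rewrite eq_le; apply/andP; split.
  by apply: ereal_inf_lbound => beta; rewrite lte_fin; exact: zeta_finite L1 NL.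
apply/ereal_infP => b /(_ 1%R) bP; rewrite leNgt; apply/negP => /bP.
by rewrite zeta1_infinite // ltxx.
Qed.

End CriticalTemperature.

(** * Indices counted by coset representatives *)

Section CosetRepresentatives.
Variable G : groupType.
Implicit Types (H : set G) (g h : G).

Lemma morph_one (f : G -> G) : {morph f : g h / g * h} -> f 1 = 1.
Proof. by move=> fM; apply: (@mulgI _ (f 1)); rewrite -fM !mulg1. Qed.

Lemma morph_inv (f : G -> G) g : {morph f : g h / g * h} -> f g^-1 = (f g)^-1.
Proof. by move=> fM; apply/esym/mulg1_eq; rewrite -fM mulgV morph_one. Qed.

Definition subgroup H :=
  [/\ H 1, forall g h, H g -> H h -> H (g * h) & forall g, H g -> H g^-1].

Lemma subgroup_range (f : G -> G) : {morph f : g h / g * h} -> subgroup (range f).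
Proof.
move=> fM; split; first by exists 1 => //; exact: morph_one.
  by move=> _ _ [g _ <-] [h _ <-]; exists (g * h); rewrite ?fM.
by move=> _ [g _ <-]; exists g^-1; rewrite ?morph_inv.
Qed.

Definition coset_reps H (T : finType) (r : T -> G) :=
  forall g, exists! t, H ((r t)^-1 * g).

Lemma left_coset_eqP H g h : subgroup H ->
  [set g * x | x in H] = [set h * x | x in H] <-> H (h^-1 * g).
Proof.
move=> [H1 HM HV]; split=> [E|hg].
  have : [set g * x | x in H] g by exists 1; rewrite ?mulg1.
  by rewrite E => -[x Hx <-]; rewrite mulKg.
apply/seteqP; split=> _ [x Hx <-].
  by exists (h^-1 * g * x); [exact: HM | rewrite -mulgA mulVKg].
exists ((h^-1 * g)^-1 * x); first by apply: HM => //; exact: HV.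
by rewrite invgM invgK -mulgA mulVKg.
Qed.

Lemma card_range_inj (T : finType) (U : Type) (f : T -> U) :
  injective f -> range f #= `I_#|T|.
Proof.
move=> f_inj; have -> : range f = range (f \o @enum_val T predT).
  apply/seteqP; split=> _ [t _ <-]; last by exists (enum_val t).
  by exists (enum_rank t); rewrite //= enum_rankK.
apply: card_eq_trans (inj_card_eq _) _; last by rewrite card_eq_sym card_II.
by move=> i j _ _ /f_inj/enum_val_inj.
Qed.

Lemma group_index_reps H (T : finType) (r : T -> G) :
  subgroup H -> coset_reps H r -> group_index H = #|T|.
Proof.
move=> sH rP; apply: card_fset_set.
have -> : left_cosets H = range (fun t => [set r t * x | x in H]).
  apply/seteqP; split=> _ [x _ <-]; last by exists (r x).
  have [t [xt _]] := rP x; exists t => //.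
  by apply/esym/left_coset_eqP.
apply: card_range_inj => t u /(left_coset_eqP _ _ sH) tu.
have [H1 _ _] := sH; have [v [_ vP]] := rP (r t).
by rewrite -(vP t) ?mulVg // (vP u).
Qed.

Lemma coset_reps_exist H : subgroup H -> finite_set (left_cosets H) ->
  exists (T : finType) (r : T -> G), coset_reps H r.
Proof.
move=> sH finH; pose T := fset_set (left_cosets H).
have Trep (t : T) : exists g, val t = [set g * x | x in H].
  by have : left_cosets H (val t) by [move: (valP t); rewrite in_fset_set // inE];
     move=> [g _ <-]; exists g.
have [r rE] := choice Trep; exists T, r => g.
have Tg : [set g * x | x in H] \in T.
  by rewrite in_fset_set // inE; exists g.
exists [` Tg]%fset; split; first by apply/left_coset_eqP => //; rewrite -rE.
by move=> t /(left_coset_eqP _ _ sH) E; apply: val_inj; rewrite /= E rE.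
Qed.

(** Representatives of [G / f (G)] and of [G / k (G)] combine, through [f], to
    representatives of [G / f (k (G))]: injectivity of [f] identifies
    [f (G) / f (k (G))] with [G / k (G)]. *)
Lemma group_index_comp (f k : G -> G) :
  {morph f : g h / g * h} -> {morph k : g h / g * h} -> injective f ->
  finite_set (left_cosets (range f)) -> finite_set (left_cosets (range k)) ->
  group_index (range (f \o k)) = (group_index (range f) * group_index (range k))%N.
Proof.
move=> fM kM f_inj finf fink.
have sf := subgroup_range fM; have sk := subgroup_range kM.
have [T [r rP]] := coset_reps_exist sf finf.
have [U [s sP]] := coset_reps_exist sk fink.
rewrite (group_index_reps sf rP) (group_index_reps sk sP) -card_prod.
apply: (group_index_reps (r := fun tu => r tu.1 * f (s tu.2))).
  by apply: subgroup_range => g h /=; rewrite kM fM.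
move=> g; have [t [[x _ xE] tP]] := rP g; have [u [[y _ yE] uP]] := sP x.
exists (t, u); split=> /= [|[t' u'] /= [y' _ y'E]].
  by exists y => //=; rewrite yE fM morph_inv // xE invgM mulgA.
have g'E : (r t')^-1 * g = f (s u' * k y').
  by rewrite fM y'E invgM -mulgA mulVKg.
have tt' : t = t' by apply: tP; exists (s u' * k y').
rewrite -tt'; congr (_, _); apply: uP; exists y' => //.
have -> : x = s u' * k y' by apply: f_inj; rewrite xE tt'.
by rewrite mulKg.
Qed.

Lemma group_index_eq1 H : subgroup H -> finite_set (left_cosets H) ->
  group_index H = 1%N -> H = setT.
Proof.
move=> sH finH; have [T [r rP]] := coset_reps_exist sH finH.
rewrite (group_index_reps sH rP) => /fintype1[t0 tE].
have rH g : H ((r t0)^-1 * g) by have [t [+ _]] := rP g; rewrite tE.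
have [H1 HM HV] := sH; apply/seteqP; split=> // g _.
have := HM _ _ (HV _ (rH 1)) (rH g).
by rewrite mulg1 invgK mulVKg.
Qed.

Lemma group_index_setT : group_index [set: G] = 1%N.
Proof.
rewrite -card_unit; apply: (@group_index_reps _ unit (fun=> 1)) => // g.
by exists tt; split=> // -[].
Qed.

Lemma group_index_gt0 H : subgroup H -> finite_set (left_cosets H) ->
  (0 < group_index H)%N.
Proof.
move=> sH finH; have [T [r rP]] := coset_reps_exist sH finH.
by rewrite (group_index_reps sH rP); have [t _] := rP 1; apply/card_gt0P; exists t.
Qed.

End CosetRepresentatives.

(** * Right LCM monoids whose core is a group *)

Section GroupCore.
Variable S : monoidType.
Hypothesis lcmS : right_LCM S.
Hypothesis core_inv : core S `<=` invertible S.
Implicit Types s t a b c : S.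

Lemma core_invertible : core S = invertible S.
Proof.
apply/seteqP; split=> // s [t st _] x; exists x.
by split; [exists (t * x); rewrite // mulgA st mul1g | exists 1; rewrite ?mulg1].
Qed.

Lemma invertible_divl s t : invertible S (s * t) -> invertible S s.
Proof.
move=> [u stu _]; have su : s * (t * u) = 1 by rewrite mulgA.
exists (t * u) => //; apply: (lcmS.1 s).
by rewrite mulgA su mul1g mulg1.
Qed.

(** When the core consists of units, the condition on factorisations in the
    definition of [core_irr] holds automatically. *)
Lemma core_irrE s : core_irr S s <-> ~ invertible S s.
Proof.
rewrite -core_invertible; split=> [[]//|nc]; split=> // t a ca _.
by rewrite -core_invertible.
Qed.

Lemma core_irr_factorisation s :
  exists t a, [/\ core_irr S t \/ t = 1, core S a & s = t * a].
Proof.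
have [cs|ns] := pselect (core S s).
  by exists 1, s; split; [right | | rewrite mul1g].
exists s, 1; split; [left | exact: core1 | by rewrite mulg1].
by apply/core_irrE; rewrite -core_invertible.
Qed.

Lemma core_irr_lcm s t r : core_irr S s -> is_right_lcm s t r -> core_irr S r.
Proof.
move=> /core_irrE ns rE; apply/core_irrE => ir; apply: ns.
have : right_ideal r r by exists 1; rewrite ?mulg1.
rewrite -rE => -[[x _ xr] _]; apply: (@invertible_divl s x); by rewrite xr.
Qed.

(** Comparing [alpha_a] with [alpha_b] amounts to looking at the fixed points of
    [alpha_(b^-1 a)], since the core is a group. *)
Lemma core_act_quotient a b : core S a -> core S b ->
  exists c, [/\ core S c, a = b * c &
    forall s, core_act a (core_class s) = core_act b (core_class s) <->
              core_rel (c * s) s].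
Proof.
move=> ca cb; have [b' bb' b'b] := core_inv cb.
have cb' : core S b' by rewrite core_invertible; exists b.
exists (b' * a); split; [exact: coreM | by rewrite mulgA bb' mul1g |].
move=> s; rewrite !(core_act_class lcmS) (core_class_eqP lcmS).
split=> [/(core_relMl b')|/(core_relMl b)]; first by rewrite !mulgA b'b mul1g.
by rewrite !mulgA bb' mul1g.
Qed.

Lemma core_act_one_eq c s : core_act c (core_class s) = core_act 1 (core_class s)
  <-> core_rel (c * s) s.
Proof. by rewrite !(core_act_class lcmS) mul1g (core_class_eqP lcmS). Qed.

Lemma core_act_faithfulE : core_act_faithful S <->
  forall c, core S c -> (forall s, core_rel (c * s) s) -> c = 1.
Proof.
split=> [faith c cc fix_c|fix1 a b ca cb ab].
  apply: contrapT => c1; have [_ [s _ <-]] := faith c 1 cc (@core1 S) c1.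
  by apply; apply/core_act_one_eq.
have [c [cc acb cP]] := core_act_quotient ca cb.
apply: contrapT => nX; apply: ab; rewrite acb (fix1 c) ?mulg1 // => s.
by apply/cP; apply: contrapT => cs; apply: nX; exists (core_class s) => //; exists s.
Qed.

Lemma core_act_almost_freeE : core_act_almost_free S <->
  forall c, core S c -> c <> 1 ->
    finite_set (@core_class S @` [set s | core_rel (c * s) s]).
Proof.
split=> [free c cc c1|fin_fix a b ca cb ab].
  apply: sub_finite_set (free c 1 cc (@core1 S) c1) => _ [s /= cs <-].
  by split; [exists s | apply/core_act_one_eq].
have [c [cc acb cP]] := core_act_quotient ca cb.
have c1 : c <> 1 by move=> c1; apply: ab; rewrite acb c1 mulg1.
apply: sub_finite_set (fin_fix c cc c1) => _ [[s _ <-] /cP cs].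
by exists s.
Qed.

End GroupCore.

(** * Semidirect products with scale determined up to units *)

Section FiniteIndexSystem.
Variables (G : groupType) (P : monoidType) (A : algDynSys G P).
Local Notation S := (sdprod A).
Local Notation pair g p := (SDProd A g p : S).
Local Notation theta := (theta A).
Local Notation N p := (group_index (range (theta p))).
Local Notation M := (range (ads_scale A)).
Hypothesis finN : forall p : P, finite_set (left_cosets (range (theta p))).
Hypothesis N_inj : forall p q : P, N p = N q ->
  exists2 u : P, invertible P u & p = q * u.
Implicit Types (g h k : G) (p q r u : P) (s t : S).

Lemma subgroup_theta p : subgroup (range (theta p)).
Proof. exact/subgroup_range/theta_morph. Qed.

Lemma scaleM p q : N (p * q) = (N p * N q)%N.
Proof.
have -> : theta (p * q) = theta p \o theta q.
  by apply/funext => g; exact: thetaM.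
by apply: group_index_comp => //; [exact: theta_morph.. | exact: theta_inj].
Qed.

Lemma scale1 : N 1 = 1%N.
Proof.
rewrite -(group_index_setT G); congr group_index.
by apply/seteqP; split=> // g _; exists g; rewrite ?theta1.
Qed.

Lemma scale_gt0 p : (0 < N p)%N.
Proof. exact: group_index_gt0 (subgroup_theta p) (finN p). Qed.

Lemma scale_unit u : invertible P u -> N u = 1%N.
Proof.
move=> [v uv _]; apply/eqP; have := scaleM u v.
by rewrite uv scale1 => /esym/eqP; rewrite muln_eq1 => /andP[].
Qed.

Lemma scale_eq1 u : N u = 1%N -> invertible P u.
Proof. by rewrite -scale1 => /N_inj[v iv ->]; rewrite mul1g. Qed.

Lemma theta_unit_onto u : invertible P u -> range (theta u) = setT.
Proof.
by move/scale_unit; apply: group_index_eq1 (finN u); exact: subgroup_theta.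
Qed.

Lemma range_theta_eq p q : N p = N q -> range (theta p) = range (theta q).
Proof.
move=> /N_inj[u iu ->]; apply/seteqP; split=> _ [g _ <-].
  by exists (theta u g); rewrite ?thetaM.
have [h _ <-] : range (theta u) g by rewrite theta_unit_onto.
by exists h; rewrite ?thetaM.
Qed.

Lemma pairM g p h q : pair g p * pair h q = pair (g * theta p h) (p * q).
Proof. by []. Qed.

Lemma pair_invertible g u : invertible P u -> invertible S (pair g u).
Proof.
move=> [v uv vu]; exists (pair (theta v g^-1) v); rewrite pairM.
  by rewrite -thetaM uv theta1 mulgV.
by rewrite -theta_morph mulVg theta_one vu.
Qed.

(** The right ideals of [(g, p)] and [(gh, p)] meet only if [h] lies in
    [theta_p(G)], so a core element has [N_p = 1]. *)
Lemma core_pairE g p : core S (pair g p) <-> invertible P p.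
Proof.
split=> [cp|ip]; last first.
  have [s gs sg] := pair_invertible g ip => t; exists t.
  by split; [exists (s * t); rewrite // mulgA gs mul1g | exists 1; rewrite ?mulg1].
have [_ HM HV] := subgroup_theta p.
apply: scale_eq1; rewrite -(group_index_setT G); congr group_index.
apply/seteqP; split=> // h _.
have [[k z] [/sd_right_idealP/= [_ gk] /sd_right_idealP/= [_ hk]]] :=
  cp (pair (g * h) p).
by have := HM _ _ gk (HV _ hk); rewrite !invgM !invgK !mulgA mulgK mulVg mul1g.
Qed.

Lemma core_sdprod_invertible : core S `<=` invertible S.
Proof. by move=> [g p] /core_pairE; exact: pair_invertible. Qed.

(** As the core is [G x P^*], the relation only forgets a unit on the right:
    classes of scale [N_q] correspond to cosets of [theta_q(G)]. *)
Lemma core_rel_pairE g p h q : core_rel (pair g p) (pair h q) <->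
  N p = N q /\ range (theta q) (h^-1 * g).
Proof.
split=> [[[k u] [[l v] [/core_pairE iu /core_pairE iv []]]]|].
  rewrite /= => gh pq; have Npq : N p = N q.
    by have := scaleM p u; rewrite pq scaleM (scale_unit iu) (scale_unit iv) !muln1.
  split=> //; have [_ HM HV] := subgroup_theta q.
  have -> : h^-1 * g = theta q l * (theta p k)^-1.
    by apply: (@mulgI _ h); rewrite mulVKg mulgA -gh mulgK.
  by apply: HM; [exists l | apply: HV; rewrite -(range_theta_eq Npq); exists k].
move=> [/N_inj[u iu ->] [l _ lE]].
exists 1, (pair l u); split; [exact: core1 | exact/core_pairE |].
by rewrite mulg1 pairM lE mulVKg.
Qed.

Lemma core_rel_scale s t : core_rel s t -> ads_scale A s = ads_scale A t.
Proof. by case: s t => [g p] [h q] /core_rel_pairE[]. Qed.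

Lemma core_rel_ideals_meet g p h q : N p = N q ->
  right_ideal (pair g p) `&` right_ideal (pair h q) !=set0 ->
  core_rel (pair g p) (pair h q).
Proof.
move=> Npq [[k z] [/sd_right_idealP/= [_ gk] /sd_right_idealP/= [_ hk]]].
apply/core_rel_pairE; split=> //; have [_ HM HV] := subgroup_theta q.
have {}gk : range (theta q) (g^-1 * k) by rewrite -(range_theta_eq Npq).
by have := HM _ _ hk (HV _ gk); rewrite invgM invgK !mulgA mulgK.
Qed.

(** Multiplication of indices is commutative, so [pq] and [qp] have the same
    scale and differ by a unit. In particular any two right ideals of [P] meet:
    this gives both the foundation property of transversals and common multiples
    of scales. *)
Lemma scale_comm p q : exists2 u, invertible P u & p * q = q * p * u.
Proof. by apply: N_inj; rewrite !scaleM mulnC. Qed.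

Lemma core_class_fibre q : exists (T : finType) (r : T -> G),
  [/\ #|T| = N q, injective (fun i => core_class (pair (r i) q)) &
    @core_class S @` (ads_scale A @^-1` [set N q]) =
    range (fun i => core_class (pair (r i) q))].
Proof.
have sq := subgroup_theta q; have [H1 _ _] := sq.
have [T [r rP]] := coset_reps_exist sq (finN q); exists T, r; split.
- by rewrite (group_index_reps sq rP).
- move=> i j /(core_class_eqP (sd_right_LCM A))/core_rel_pairE[_ ji].
  have [l [_ lP]] := rP (r i).
  by rewrite -(lP i) ?mulVg // (lP j).
- apply/seteqP; split=> [_ [[g p] /= Npq <-]|_ [i _ <-]]; last by exists (pair (r i) q).
  have [i [gi _]] := rP g; exists i => //.
  by apply/esym/(core_class_eqP (sd_right_LCM A))/core_rel_pairE; split.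
Qed.

(** If a transversal had two equivalent points, one of them could be removed. *)
Lemma transversal_inj (B : set S) T s t : Defs.transversal B T -> T s -> T t ->
  core_rel s t -> s = t.
Proof.
move=> [[TB Trep] Tmin] Ts Tt st; apply: contrapT => s_t.
have : T `\ t = T.
  apply: Tmin; first by move=> x [].
  split=> [x [/TB]//|x /Trep[y Ty xy]].
  have [yt|yt] := pselect (y = t); last by exists y.
  exists s; first by split.
  apply: (core_rel_trans (sd_right_LCM A) xy); rewrite yt.
  exact: core_rel_sym.
by move=> TE; have : T t := Tt; rewrite -TE => -[_]; apply.
Qed.

(** Accuracy: elements of equal scale with meeting right ideals are equivalent.
    Foundation: the ideal of [(h, p)] meets that of the representative [(g, p')]
    of the class of [(h, q)], for any [q] of the given scale. Indeed
    [g^-1 h] lies in [theta_p'(G)] and [p p'] in [p' P], so both ideals contain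
    [(h, p p')]. *)
Lemma transversal_foundation q T : Defs.transversal (ads_scale A @^-1` [set N q]) T ->
  foundation_set T /\ accurate T.
Proof.
move=> trT; have [[TN Trep] _] := trT.
split; last first.
  move=> [g p] [h p'] Tg Th gh; apply/eqP/negPn/negP => /set0P meet.
  have Npp : N p = N p' by exact: etrans (TN _ Tg) (esym (TN _ Th)).
  by apply: gh; apply: transversal_inj trT Tg Th (core_rel_ideals_meet Npp meet).
split.
  have [U [r [_ _ rE]]] := core_class_fibre q.
  have TU : @core_class S @` T `<=` range (fun i => core_class (pair (r i) q)).
    by rewrite -rE => _ [t /TN Tt <-]; exists t.
  have cinj : {in T &, injective (@core_class S)}.
    move=> s t; rewrite !inE => Ts Tt /(core_class_eqP (sd_right_LCM A)).
    exact: transversal_inj trT Ts Tt.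
  rewrite -(eq_finite_set (inj_card_eq cinj)).
  by apply: sub_finite_set TU _; exact: finite_image.
move=> [h p]; have [|[g p'] Tg /core_rel_pairE[Nq hg]] := Trep (pair h q) => //.
exists (pair g p') => //; have [u _ puE] := scale_comm p p'.
exists (pair h (p * p')); split; apply/sd_right_idealP => /=.
  split; [by exists p' | by rewrite mulVg; have [] := subgroup_theta p].
by split=> //; exists (p * u); rewrite // puE mulgA.
Qed.

Lemma range_scaleP n : M n <-> exists p, n = N p.
Proof.
split=> [[[g p] _ <-]|[p ->]]; first by exists p.
by exists (pair 1 p).
Qed.

(** Since scales determine elements of [P] up to units, [N_z] is a multiple of
    [N_p] within the scales exactly when [z] lies in [pP]; so the scale of a right
    LCM of [p] and [q] is a least common multiple of [N_p] and [N_q]. *)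
Lemma range_scale_lcm a b : M a -> M b ->
  exists c, forall x, dvd_in M a x /\ dvd_in M b x <-> dvd_in M c x.
Proof.
move=> /range_scaleP[p ->] /range_scaleP[q ->].
have [u [v _ vu] pqu] := scale_comm p q.
have [E|[r rE]] := (ads_right_LCM A).2 p q.
  have : (right_ideal p `&` right_ideal q) (p * q).
    by split; [exists q | exists (p * u); rewrite // pqu mulgA].
  by rewrite E.
have : right_ideal r r by exists 1; rewrite ?mulg1.
rewrite -rE => -[[x _ xr] [y _ yr]].
exists (N r) => n; split=> [[[_ /range_scaleP[k ->] nk] [_ /range_scaleP[l ->] nl]]|].
  have [w iw klw] : exists2 w, invertible P w & p * k = q * l * w.
    by apply: N_inj; rewrite !scaleM -nk.
  have : right_ideal r (p * k).
    by rewrite -rE; split; [exists k | exists (l * w); rewrite // klw mulgA].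
  move=> [z _ zE]; exists (N z); first by apply/range_scaleP; exists z.
  by rewrite nk -!scaleM zE.
move=> [_ /range_scaleP[k ->] ->]; split.
  exists (N (x * k)); first by apply/range_scaleP; exists (x * k).
  by rewrite -xr !scaleM mulnA.
exists (N (y * k)); first by apply/range_scaleP; exists (y * k).
by rewrite -yr !scaleM mulnA.
Qed.

Lemma range_scale_gt0 n : M n -> (0 < n)%N.
Proof. by move=> /range_scaleP[p ->]; exact: scale_gt0. Qed.

Lemma range_scale1 : M 1%N.
Proof. by apply/range_scaleP; exists 1; rewrite scale1. Qed.

Lemma range_scaleM m n : M m -> M n -> M (m * n)%N.
Proof.
move=> /range_scaleP[p ->] /range_scaleP[q ->]; apply/range_scaleP.
by exists (p * q); rewrite scaleM.
Qed.

Hypothesis nontriv : exists p, ~ bijective (theta p).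

Lemma scale_nontrivial : exists p, N p <> 1%N.
Proof.
have [p nb] := nontriv; exists p => Np; apply: nb; rewrite -setTT_bijective.
split=> //; last by move=> g _; rewrite (theta_unit_onto (scale_eq1 Np)).
by move=> g h _ _; exact: theta_inj.
Qed.

Lemma range_scale_infinite : infinite_set M.
Proof.
have [p Np] := scale_nontrivial.
have N1 : (1 < N p)%N by rewrite ltn_neqAle eq_sym scale_gt0 andbT; apply/eqP.
apply: (@sub_infinite_set _ (range (expn (N p)))).
  move=> _ [n _ <-]; elim: n => [|n IH]; first exact: range_scale1.
  by rewrite expnS; apply: range_scaleM IH; apply/range_scaleP; exists p.
suff /eq_finite_set -> : range (expn (N p)) #= [set: nat] by exact: infinite_nat.
by apply: inj_card_eq => m n _ _ /eqP; rewrite eqn_exp2l // => /eqP.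
Qed.

Lemma sdprod_admissible : admissible (ads_scale A).
Proof.
have lcmS := sd_right_LCM A; have cinv := core_sdprod_invertible.
split.
- exact: core_irr_factorisation.
- by move=> s t r cs _; exact: core_irr_lcm.
- split; last by move=> _ [[g p] _ <-] T; exact: transversal_foundation.
    split; [by move=> s; exact: scale_gt0 | exact: scale1 | |].
      by move=> s t; exact: scaleM.
    by have [p Np] := scale_nontrivial; exists (pair 1 p).
  move=> _ [[g q] _ <-]; have [T [r [TN r_inj rE]]] := core_class_fibre q.
  by rewrite /ads_scale /= rE -TN; exact: card_range_inj.
apply: lcm_submonoid_free; [exact: range_scale_gt0 | exact: range_scale1 | |].
  exact: range_scaleM.
exact: range_scale_lcm.
Qed.

Lemma P_class_scaleP p q : P_class A p q <-> N p = N q.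
Proof.
rewrite /P_class /=; split=> [/core_rel_pairE[]//|Npq].
by apply/core_rel_pairE; split=> //; rewrite mulVg; have [] := subgroup_theta q.
Qed.

Lemma P_class_scale_eq p q : P_class A p = P_class A q <-> N p = N q.
Proof. by rewrite P_class_eqP; exact: P_class_scaleP. Qed.

Lemma P_class_irr p : irreducibles M muln 1%N (N p) -> P_quot_irr A (P_class A p).
Proof.
move=> [_ N1 Nirr]; split; first by exists p.
  by move/P_class_scale_eq; rewrite scale1.
move=> _ _ [k _ <-] [l _ <-].
rewrite P_quot_mul_class; last first.
  move=> k' l' /P_class_scaleP kk' /P_class_scaleP ll'; apply/P_class_scaleP.
  by rewrite !scaleM kk' ll'.
move/P_class_scale_eq; rewrite scaleM => Nkl.
have Mr r : M (N r) by apply/range_scaleP; exists r.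
by case: (Nirr _ _ (Mr k) (Mr l) Nkl) => E; [left | right];
   apply/P_class_scale_eq; rewrite E scale1.
Qed.

(** Choosing for each scale in [B] an element of [P] that realises it embeds [B]
    into the set of values of [f]. *)
Lemma finite_scale_image (U : Type) (f : P -> U) (B : set nat) :
  B `<=` M -> (forall p q, f p = f q -> N p = N q) ->
  finite_set (f @` [set p | B (N p)]) -> finite_set B.
Proof.
move=> BM fN fin.
have [|rho rhoP] := @choice _ _ (fun n p => M n -> n = N p).
  move=> n; have [/range_scaleP[p pn]|nM] := pselect (M n); first by exists p.
  by exists 1.
have rho_inj : {in B &, injective (f \o rho)}.
  move=> m n; rewrite !inE => Bm Bn /fN.
  by rewrite -!rhoP; do ?exact: BM.
rewrite -(eq_finite_set (inj_card_eq rho_inj)).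
apply: sub_finite_set fin => _ [n Bn <-]; exists (rho n) => //=.
by rewrite -rhoP //; exact: BM.
Qed.

Lemma beta_c_sdprod (R : realType) : finite_set (P_quot_irr A) ->
  beta_c (ads_scale A) R = 1%E.
Proof.
move=> finI; set I := irreducibles M muln 1%N.
have IM : I `<=` M by exact: irr_sub.
have {}finI : finite_set I.
  apply: (finite_scale_image IM (f := P_class A)).
    by move=> p q /P_class_scale_eq.
  by apply: sub_finite_set finI => _ [p Ip <-]; exact: P_class_irr.
apply: (@beta_c_eq1 _ _ _ (fset_set I)) range_scale_infinite.
  move=> x; rewrite in_fset_set // inE; apply: irr_gt1; exact: range_scale_gt0.
have [_ _ _ [_ fact _]] := sdprod_admissible.
move=> n /fact[s sI ->]; exists s => // x /sI Ix.
by rewrite in_fset_set // inE.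
Qed.

Definition twisted_conjugates p s : set G :=
  [set sdl s * theta (sdr s) g * (theta p (sdl s))^-1 | g in [set: G]].

(** [uq] and [q] have the same scale, so [(g, u)] fixes the class of [(h, q)]
    as soon as [g theta_u(h)] lies in the coset [h theta_q(G)]. *)
Lemma core_fixE g u s : invertible P u ->
  core_rel (pair g u * s) s <-> twisted_conjugates u s g.
Proof.
case: s => h q iu; rewrite /twisted_conjugates pairM core_rel_pairE /=.
split=> [[_ [k _ kE]]|[k _ <-]]; first by exists k; rewrite // kE mulVKg mulgK.
split; first by rewrite scaleM (scale_unit iu) mul1n.
by exists k; rewrite // -!mulgA mulVg mulg1 mulKg.
Qed.

Lemma sdprod_faithful : core_act_faithful S <->
  forall g u, invertible P u -> (forall s, twisted_conjugates u s g) ->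
    g = 1 /\ u = 1.
Proof.
rewrite (core_act_faithfulE (sd_right_LCM A) core_sdprod_invertible).
split=> [fix1 g u iu gfix|fix1 [g u] /core_pairE iu gfix].
  suff [-> ->] : pair g u = 1 by [].
  by apply: fix1 => [|s]; [exact/core_pairE | exact/core_fixE].
by have [|-> ->] := fix1 g u iu => // s; apply/core_fixE.
Qed.

Lemma sdprod_almost_free : core_act_almost_free S <->
  forall g u, invertible P u -> (g, u) <> (1, 1) ->
    finite_set (@core_class S @` [set s | twisted_conjugates u s g]).
Proof.
rewrite (core_act_almost_freeE (sd_right_LCM A) core_sdprod_invertible).
have fixE g u : invertible P u -> [set s | core_rel (pair g u * s) s] =
    [set s | twisted_conjugates u s g].
  by move=> iu; apply/seteqP; split=> s /= /(core_fixE _ _ iu).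
split=> [free g u iu gu|free [g u] /core_pairE iu gu].
  rewrite -fixE //; apply: free; first exact/core_pairE.
  by move=> -[g1 u1]; apply: gu; rewrite g1 u1.
by rewrite fixE //; apply: free => // -[g1 u1]; apply: gu; rewrite g1 u1.
Qed.

(** [(1, u)] fixes the classes of all [(1, q)], and these are infinitely many. *)
Lemma almost_free_units : core_act_almost_free S -> invertible P = [set 1].
Proof.
move=> /sdprod_almost_free free; apply/seteqP; split=> [u iu|_ ->]; last first.
  by exists 1; rewrite mulg1.
apply: contrapT => u1; apply: range_scale_infinite.
apply: (finite_scale_image (f := fun q => core_class (pair 1 q))) => //.
  by move=> p q /(core_class_eqP (sd_right_LCM A))/core_rel_scale.
have fin : finite_set (@core_class S @` [set s | twisted_conjugates u s 1]).
  by apply: free => // -[/u1].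
apply: sub_finite_set fin => _ [q _ <-]; exists (pair 1 q) => //=.
by exists 1; rewrite //= !theta_one mul1g mulgV.
Qed.

Lemma twisted_conjugates1 s : twisted_conjugates 1 s =
  [set sdl s * theta (sdr s) g * (sdl s)^-1 | g in [set: G]].
Proof. by rewrite /twisted_conjugates theta1. Qed.

End FiniteIndexSystem.

(** * The proposition *)

Theorem proposition5p11 (R : realType) (G : groupType) (P : monoidType)
    (A : algDynSys G P)
    (ha : forall p : P, finite_set (left_cosets (range (theta A p))))
    (hb : exists p : P, ~ bijective (theta A p))
    (hc : forall p : P, bijective (theta A p) -> invertible P p)
    (hd : forall p q : P,
        group_index (range (theta A p)) = group_index (range (theta A q)) ->
        exists2 u : P, invertible P u & p = q * u) :
  (admissible (ads_scale A) /\
   (finite_set (P_quot_irr A) -> beta_c (ads_scale A) R = 1%E)) /\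
  (core_act_faithful (sdprod A) <->
   (\bigcap_(s in [set: sdprod A])
      [set sdl s * theta A (sdr s) g * (sdl s)^-1 | g in [set: G]] = [set 1] /\
    forall p : P, invertible P p -> p <> 1 ->
      \bigcap_(s in [set: sdprod A])
        [set sdl s * theta A (sdr s) g * (theta A p (sdl s))^-1 | g in [set: G]]
      = set0)) /\
  (core_act_almost_free (sdprod A) <->
   (invertible P = [set 1] /\
    forall h : G, h <> 1 ->
      finite_set
        [set core_class (s : sdprod A) | s in
           [set s : sdprod A |
              [set sdl s * theta A (sdr s) g * (sdl s)^-1 | g in [set: G]] h]])).
Proof.
have tw1 := twisted_conjugates1 (A := A).
split; first split.
- exact: sdprod_admissible.
- exact: beta_c_sdprod.
split.
  rewrite sdprod_faithful //; split=> [fix1|[conj1 twist0] g u iu gfix].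
    split=> [|p ip p1].
      apply/seteqP; split=> [g gconj|_ -> s _]; last first.
        by exists 1; rewrite // theta_one mulg1 mulgV.
      have [|s|//] := fix1 g 1; first by exists 1; rewrite mulg1.
      by rewrite tw1; apply: gconj.
    apply/seteqP; split=> // g gtw; apply: p1.
    by have [s|] := fix1 g p ip; first exact: gtw.
  have [u1|u1] := pselect (u = 1).
    split=> //; suff : [set 1] g by [].
    by rewrite -conj1 => s _; rewrite -tw1 -u1.
  have : set0 g by rewrite -(twist0 u iu u1) => s _; exact: gfix.
  by [].
split=> [free|[units fin]].
  split=> [|h h1]; first exact: (almost_free_units ha hd hb).
  have := (sdprod_almost_free ha hd).1 free h 1.
  under eq_set do rewrite tw1.
  by apply; [exists 1; rewrite mulg1 | case].
apply/(sdprod_almost_free ha hd) => g u; rewrite units => -> gu.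
under eq_set do rewrite tw1.
by apply: fin => g1; apply: gu; rewrite g1.
Qed.
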